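(* Let $\mathcal{H}$ be a Hilbert space with $\dim(\mathcal{H})\geq 2$ and let $d\in\mathbb{N}$ with $d\geq 2$. Then there exist $d$-parameter contractive $C_0$-semigroups $T$ over $\mathcal{H}$ with bounded generators, each of which has a strictly negative spectral bound, for which regular polynomial bounds fail (i.e. $T$ does not satisfy regular polynomial bounds).
   Context: Hilbert spaces are complex; $\mathfrak{L}(\mathcal{H})$ denotes bounded operators; $\mathbb{N}=\{1,2,\ldots\}$; $\mathbb{T}=\{z\in\mathbb{C}:|z|=1\}$. A $d$-parameter $C_0$-semigroup over $\mathcal{H}$ is a map $T:\mathbb{R}_{\geq 0}^{d}\to\mathfrak{L}(\mathcal{H})$, continuous for the strong operator topology, with $T(\mathbf{0})=I$ and $T(\mathbf{s}+\mathbf{t})=T(\mathbf{s})T(\mathbf{t})$; it is contractive if $\|T(\mathbf{t})\|\leq 1$ for all $\mathbf{t}$. Its marginals are the commuting one-parameter $C_0$-semigroups $T_i(t)=T(t\mathbf{e}_i)$ ($\mathbf{e}_i$ the canonical unit vectors), and its generators are the infinitesimal generators of $T_1,\ldots,T_d$. The spectral bound of an operator $A$ is $\sup\{\mathrm{Re}\,\lambda:\lambda\in\sigma(A)\}$. Regular polynomial evaluation: for commuting $S_1,\ldots,S_d\in\mathfrak{L}(\mathcal{H})$, the map $p\mapsto p(S_1,\ldots,S_d)$ from $\mathbb{C}[X_1,X_1^{-1},\ldots,X_d,X_d^{-1}]$ to $\mathfrak{L}(\mathcal{H})$ is the unique linear map sending each monomial $\prod_{i=1}^d X_i^{n_i}$,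 $\mathbf{n}\in\mathbb{Z}^d$, to $\big(\prod_{i:\,n_i<0}S_i^{-n_i}\big)^{*}\big(\prod_{i:\,n_i>0}S_i^{n_i}\big)$. $T$ satisfies regular polynomial bounds if $$\|p(T_1(t_1),\ldots,T_d(t_d))\|\leq\sup_{\boldsymbol{\lambda}\in\mathbb{T}^d}|p(\lambda_1,\ldots,\lambda_d)|$$ for all $p\in\mathbb{C}[X_1,X_1^{-1},\ldots,X_d,X_d^{-1}]$ and all $\mathbf{t}=(t_i)_{i=1}^d\in\mathbb{R}_{\geq 0}^{d}$. *)

(* Defs.v *)
From mathcomp Require Import all_boot all_order all_algebra.
From mathcomp Require Import finmap complex.
From mathcomp Require Import all_classical all_reals all_analysis.
Import Order.TTheory GRing.Theory Num.Theory Num.Def.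
Import numFieldNormedType.Exports.

Set Implicit Arguments.
Unset Strict Implicit.
Unset Printing Implicit Defensive.

Local Open Scope classical_set_scope.
Local Open Scope complex_scope.
Local Open Scope ring_scope.

(* A complex Hilbert space is a complete normed module [H] over [R[i]] together
   with a positive definite Hermitian form [dot] inducing its norm. The norm of
   [H] takes its values in the nonnegative reals of [R[i]]; [rnorm] is the same
   norm with values in [R]. *)
Definition hilbert_norm (R : realType) (H : normedModType R[i])
  (dot : {dot H for conjC}) : Prop :=
  forall x : H, `|x| ^+ 2 = dot x x.

Definition rnorm (R : realType) (V : normedZmodType R[i]) (x : V) : R :=
  complex.Re `|x|.

Definition dim_ge (R : realType) (H : normedModType R[i]) (n : nat) : Prop :=
  exists v : 'I_n -> H, forall c : 'I_n -> R[i],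
    \sum_(i < n) c i *: v i = 0 -> forall i, c i = 0.

Section Operators.
Context {R : realType} {H : normedModType R[i]}.
Implicit Types A B : {linear H -> H}.

Definition bounded_op A : Prop :=
  exists M : R, forall x, `|A x| <= M%:C * `|x|.

(* Meaningful for bounded operators only: [sup] of an unbounded set is [0]. *)
Definition opnorm (f : H -> H) : R :=
  sup [set rnorm (f x) | x in [set x : H | `|x| <= 1]].

Definition spectrum A : set R[i] :=
  [set z | ~ exists2 B, bounded_op B &
     forall x, B (z *: x - A x) = x /\ z *: B x - A (B x) = x].

Definition spectral_bound A : \bar R :=
  ereal_sup [set (complex.Re z)%:E | z in spectrum A].

(* [adjoint dot f y] is the vector representing the functional
   [x |-> dot (f x) y]; it exists (Riesz) when [f] is a bounded operator on a
   Hilbert space. *)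
Definition adjoint (dot : {dot H for conjC}) (f : H -> H) (y : H) : H :=
  xget 0 [set z | forall x, dot (f x) y = dot x z].

End Operators.

Section Semigroups.
Context {R : realType} {H : normedModType R[i]} {d : nat}.

Definition orthant : set 'rV[R]_d := [set t | forall i, 0 <= t 0 i].

(* A [d]-parameter family is a function on all of [R^d], of which only the
   values on the closed orthant matter. *)
Implicit Type T : 'rV[R]_d -> {linear H -> H}.

Definition C0_semigroup T : Prop :=
  [/\ forall t, orthant t -> bounded_op (T t),
      forall x, T 0 x = x,
      forall s t, orthant s -> orthant t -> forall x, T (s + t) x = T s (T t x)
    & forall x, {within orthant, continuous (fun t => T t x)}].

Definition contractive T : Prop :=
  forall t, orthant t -> opnorm (T t) <= 1.

Definition marginal T (i : 'I_d) (t : R) : {linear H -> H} :=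
  T (t *: delta_mx 0 i).

(* The infinitesimal generator of the one-parameter semigroup [S] is everywhere
   defined and is the bounded operator [A]. *)
Definition has_bounded_generator (S : R -> {linear H -> H})
    (A : {linear H -> H}) : Prop :=
  bounded_op A /\
  forall x, (t^-1)%:C *: (S t x - x) @[t --> 0^'+] --> A x.

End Semigroups.

(* Elements of [C[X_1, X_1^-1, ..., X_d, X_d^-1]], encoded by their finitely
   supported families of coefficients, indexed by exponents in [Z^d]. *)
Definition laurent (R : realType) (d : nat) : Type :=
  {fsfun {ffun 'I_d -> int} -> R[i] with 0}.

Section RegularPolynomials.
Context {R : realType} {d : nat}.
Implicit Type p : laurent R d.

Definition laurent_eval p (z : 'I_d -> R[i]) : R[i] :=
  \sum_(n <- finsupp p) p n * \prod_(i < d) z i ^ n i.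

Definition torus : set ('I_d -> R[i]) := [set z | forall i, `|z i| = 1].

Definition laurent_sup p : R :=
  sup [set rnorm (laurent_eval p z) | z in torus].

Context {H : normedModType R[i]} (dot : {dot H for conjC}).

Definition regular_monomial (n : {ffun 'I_d -> int}) (S : 'I_d -> H -> H) :
    H -> H :=
  adjoint dot (\big[(fun f g => f \o g)/id]_(i < d | n i < 0)
                  iter `|n i|%N (S i))
  \o \big[(fun f g => f \o g)/id]_(i < d | 0 < n i) iter `|n i|%N (S i).

Definition regular_eval p (S : 'I_d -> H -> H) (x : H) : H :=
  \sum_(n <- finsupp p) p n *: regular_monomial n S x.

Definition regular_polynomial_bounds (T : 'rV[R]_d -> {linear H -> H}) : Prop :=
  forall p (t : 'rV[R]_d), orthant t ->
    opnorm (regular_eval p (fun i => marginal T i (t 0 i))) <= laurent_sup p.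

End RegularPolynomials.

(* Main.v *)
From HB Require Import structures.
Require Import Defs.
From mathcomp Require Import all_boot all_order all_algebra.
From mathcomp Require Import finmap complex.
From mathcomp Require Import all_classical all_reals all_analysis.
From mathcomp Require Import ring lra.
Import Order.TTheory GRing.Theory Num.Theory Num.Def.
Import numFieldNormedType.Exports.
Set Implicit Arguments.
Unset Strict Implicit.
Unset Printing Implicit Defensive.
Local Open Scope complex_scope.
Local Open Scope ring_scope.

(** Let [e], [f] be orthonormal and let [N x = <x, f> e], so that [N^2 = 0] and
    the operators [a + c N] multiply like dual numbers. The generator
    [A = -1 + 2 N] has spectrum contained in [{-1}]. It is dissipative, because
    [|<N x, x>| <= |x|^2 / 2] and so [Re <A x, x> <= 0]; hence
    [S t = exp (t A) = exp (-t) (1 + 2 t N)] is a contraction semigroup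
    ([shear_semigroup_contractive]). The counterexample is
    [T t = S (t_1 + ... + t_d)], all of whose marginals are equal to [S].

    Regular polynomial bounds would make the regular evaluation positive: the
    Laurent polynomial [p = |(1 - X) (1 - Y)|^2 = (2 - X - X^-1) (2 - Y - Y^-1)]
    satisfies [0 <= p <= 16] on the torus, so [16 - p] has norm at most [16]
    there ([test_laurent_sup]), and the bound for [16 - p] would give
    [<p(S t, S t) x, x> >= 0] for unit vectors [x]. But the regular evaluation
    puts every adjoint on the left, whence
    [<p(S t, S t) x, x> =
     4 |x|^2 - 8 Re <S t x, x> + 2 Re <S (2 t) x, x> + 2 |S t x|^2].
    As [t] tends to [0] this is [2 t^2 (|A x|^2 + Re <A^2 x, x>)] up to higher
    order terms, and dissipativity of [A] does not control the sign of
    [|A x|^2 + Re <A^2 x, x>]: at [x = (4 e + 3 f) / 5] it is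
    [13/25 - 23/25 < 0]. The time [t = 1/4] is already small enough
    ([test_moments_large]). *)

(** * Inner products and adjoints *)

Section HilbertSpace.
Context {R : realType} {H : normedModType R[i]} (dot : {dot H for conjC}).
Hypothesis hdot : hilbert_norm dot.

Lemma dotZl a x y : dot (a *: x) y = a * dot x y.
Proof. exact: linearZl_LR. Qed.

Lemma dotDl x y z : dot (x + y) z = dot x z + dot y z.
Proof. exact: linearDl. Qed.

Lemma dotBl x y z : dot (x - y) z = dot x z - dot y z.
Proof. exact: linearBl. Qed.

Definition rdot (x y : H) : R := complex.Re (dot x y).

Lemma norm_rnorm (V : normedZmodType R[i]) (x : V) : `|x| = (rnorm x)%:C.
Proof. by rewrite /rnorm RRe_real // ger0_real. Qed.

Lemma rnorm_ge0 (V : normedZmodType R[i]) (x : V) : 0 <= rnorm x.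
Proof. by rewrite -lecR -norm_rnorm normr_ge0. Qed.

Lemma rdotxx (x : H) : rdot x x = rnorm x ^+ 2.
Proof. by rewrite /rdot -hdot norm_rnorm -rmorphXn. Qed.

Lemma dotC (x y : H) : dot x y = (dot y x)^*.
Proof. by rewrite hermC expr0 mul1r. Qed.

Lemma dotZr a x y : dot x (a *: y) = a^* * dot x y.
Proof. by rewrite dotC dotZl rmorphM [in RHS]dotC. Qed.

Lemma dotDr x y z : dot z (x + y) = dot z x + dot z y.
Proof. by rewrite dotC dotDl rmorphD (dotC z x) (dotC z y). Qed.

Lemma dotBr x y z : dot z (x - y) = dot z x - dot z y.
Proof. by rewrite dotC dotBl rmorphB (dotC z x) (dotC z y). Qed.

Lemma rdotC (x y : H) : rdot x y = rdot y x.
Proof. by rewrite /rdot dotC; case: (dot y x). Qed.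

Lemma rdotDl x y z : rdot (x + y) z = rdot x z + rdot y z.
Proof. by rewrite /rdot dotDl raddfD. Qed.

Lemma rdotBl x y z : rdot (x - y) z = rdot x z - rdot y z.
Proof. by rewrite /rdot dotBl raddfB. Qed.

Lemma Re_real_mul (a : R) (z : R[i]) : complex.Re (a%:C * z) = a * complex.Re z.
Proof. by case: z => b c /=; rewrite mul0r subr0. Qed.

Lemma rdotZl (a : R) x y : rdot (a%:C *: x) y = a * rdot x y.
Proof. by rewrite /rdot dotZl Re_real_mul. Qed.

Lemma rdotDr x y z : rdot z (x + y) = rdot z x + rdot z y.
Proof. by rewrite rdotC rdotDl !(rdotC _ z). Qed.

Lemma rdotBr x y z : rdot z (x - y) = rdot z x - rdot z y.
Proof. by rewrite rdotC rdotBl !(rdotC _ z). Qed.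

Lemma rdotZr (a : R) x y : rdot y (a%:C *: x) = a * rdot y x.
Proof. by rewrite rdotC rdotZl rdotC. Qed.

(** Gram-Schmidt applied to two independent vectors. *)
Lemma orthonormal_pair : dim_ge H 2 ->
  exists e f : H, [/\ dot e e = 1, dot f f = 1 & dot e f = 0].
Proof.
move=> [v hv].
have normalize (x : H) : x != 0 -> dot (`|x|^-1 *: x) (`|x|^-1 *: x) = 1.
  move=> x0; rewrite dnormZ -hdot -exprMn normfV normr_id mulVf ?expr1n//.
  by rewrite normr_eq0.
have v0 : v ord0 != 0.
  apply/eqP => v0; have := hv (fun i => (i == ord0)%:R).
  rewrite big_ord_recl big_ord1 /= v0 scaler0 scale0r addr0 => /(_ erefl ord0).
  by rewrite eqxx => /eqP; rewrite oner_eq0.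
set e := `|v ord0|^-1 *: v ord0; have ee : dot e e = 1 by exact: normalize.
set w := v (lift ord0 ord0) - dot (v (lift ord0 ord0)) e *: e.
have ew : dot w e = 0 by rewrite dotBl dotZl ee mulr1 subrr.
have w0 : w != 0.
  apply/eqP => w0.
  have := hv (fun i =>
    if i == ord0 then - dot (v (lift ord0 ord0)) e * `|v ord0|^-1 else 1).
  rewrite big_ord_recl big_ord1 /= scale1r -scalerA scaleNr addrC.
  by move=> /(_ w0 (lift ord0 ord0)) /eqP; rewrite oner_eq0.
exists e, (`|w|^-1 *: w); split => //; first exact: normalize.
by rewrite dotC dotZl ew mulr0 rmorph0.
Qed.

(** An explicit formal adjoint [g'] of [g] makes the set from which [adjoint]
    chooses nonempty, so the representation theorem of Riesz does not enter. *)
Lemma dot_adjoint (g g' : H -> H) (x y : H) :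
  (forall u v, dot (g u) v = dot u (g' v)) -> dot (g x) y = dot x (adjoint dot g y).
Proof.
move=> gg'; pose P := [set z | forall u, dot (g u) y = dot u z]%classic.
have Pz : exists z, P z by exists (g' y) => u; exact: gg'.
exact: (xgetPex 0 Pz x).
Qed.

(** With [z = g^* y], the real inner product of [g z] and [y] is [|z|^2], and it
    is at most [(|g z|^2 + |y|^2) / 2 <= (|z|^2 + |y|^2) / 2]. *)
Lemma rnorm_adjoint (g g' : H -> H) (y : H) :
  (forall u v, dot (g u) v = dot u (g' v)) ->
  (forall u, rnorm (g u) <= rnorm u) -> rnorm (adjoint dot g y) <= rnorm y.
Proof.
move=> gg' ctr; set z := adjoint dot g y.
have zE : rnorm z ^+ 2 = rdot (g z) y.
  by rewrite -rdotxx /rdot (dot_adjoint _ _ gg').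
have := sqr_ge0 (rnorm (g z - y)); rewrite -rdotxx rdotBl !rdotBr.
rewrite (rdotC y (g z)) -zE !rdotxx => le0.
have := ctr z; have := rnorm_ge0 z; have := rnorm_ge0 y; have := rnorm_ge0 (g z).
move=> *; rewrite -ler_sqr ?nnegrE//; nra.
Qed.

End HilbertSpace.

(** * Dual numbers as operators *)

Section DualNumbers.
Context {R : realType} {H : normedModType R[i]} (dot : {dot H for conjC}).
Variables e f : H.

(** The operator [a + c N] with [N = <-, f> e]; when [<e, f> = 0] the operator
    [N] squares to zero and plays the part of the dual unit. *)
Definition dualop (a c : R[i]) (x : H) : H := a *: x + c *: (dot x f *: e).

Lemma dualop_is_linear a c : linear (dualop a c).
Proof.
move=> k x y; rewrite /dualop linearPl scalerDr scalerDl !scalerA.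
rewrite !scalerDr !scalerA addrACA; congr (_ + _ + (_ + _)).
- by rewrite mulrC.
- by rewrite mulrCA mulrA.
Qed.

HB.instance Definition _ a c :=
  GRing.isLinear.Build R[i] H H *:%R (dualop a c) (dualop_is_linear a c).

Hypothesis ef : dot e f = 0.

Lemma dualopM a c a' c' x :
  dualop a c (dualop a' c' x) = dualop (a * a') (a * c' + c * a') x.
Proof.
rewrite /dualop dotDl !dotZl ef !mulr0 addr0.
by rewrite scalerDr !scalerA -addrA -scalerDl mulrDl !mulrA.
Qed.

End DualNumbers.

Section DualOperators.
Context {R : realType} {H : normedModType R[i]} (dot : {dot H for conjC}).
Hypothesis hdot : hilbert_norm dot.

Variables e f : H.
Hypothesis ee : dot e e = 1.
Hypothesis ff : dot f f = 1.
Hypothesis ef : dot e f = 0.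

Lemma dualop_adjoint a c x y :
  dot (dualop dot e f a c x) y = dot x (dualop dot f e a^* c^* y).
Proof.
rewrite /dualop dotDl !dotZl dotDr !dotZr !conjCK (dotC dot y e) conjCK.
by rewrite (mulrC (dot x f)) mulrA.
Qed.

Lemma bessel_ef (x : H) :
  complex.Re (dot x e) ^+ 2 + complex.Im (dot x e) ^+ 2 +
  (complex.Re (dot x f) ^+ 2 + complex.Im (dot x f) ^+ 2) <= rnorm x ^+ 2.
Proof.
rewrite -lecR rmorphD /= !add_Re2_Im2.
rewrite rmorphXn /= -norm_rnorm hdot !normCK.
set w := x - dot x e *: e - dot x f *: f.
have fe : dot f e = 0 by rewrite dotC ef rmorph0.
have we : dot w e = 0 by rewrite !dotBl !dotZl ee fe mulr0 mulr1 subr0 subrr.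
have wf : dot w f = 0 by rewrite !dotBl !dotZl ff ef mulr0 mulr1 subr0 subrr.
have := dnorm_ge0 dot w.
have -> : dot w w = dot x w.
  rewrite [in LHS]/w !dotBl !dotZl (dotC dot e w) (dotC dot f w) we wf.
  by rewrite rmorph0 !mulr0 !subr0.
by rewrite !dotBr !dotZr -addrA -opprD subr_ge0 -/w ![(dot x _)^* * _]mulrC.
Qed.

Lemma rnorm_dualop (p q : R) (x : H) :
  rnorm (dualop dot e f p%:C q%:C x) ^+ 2 = p ^+ 2 * rnorm x ^+ 2 +
    2 * p * q * (complex.Re (dot x e) * complex.Re (dot x f) +
                 complex.Im (dot x e) * complex.Im (dot x f)) +
    q ^+ 2 * (complex.Re (dot x f) ^+ 2 + complex.Im (dot x f) ^+ 2).
Proof.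
rewrite -!(rdotxx hdot) /dualop rdotDl !rdotDr !rdotZl !rdotZr.
have -> : rdot dot (dot x f *: e) (dot x f *: e) =
    complex.Re (dot x f) ^+ 2 + complex.Im (dot x f) ^+ 2.
  rewrite /rdot dotZl dotZr ee mulr1; case: (dot x f) => b c /=.
  by rewrite mulrN opprK !expr2.
rewrite (rdotC _ x); have -> : rdot dot (dot x f *: e) x =
    complex.Re (dot x e) * complex.Re (dot x f) +
    complex.Im (dot x e) * complex.Im (dot x f).
  rewrite /rdot dotZl (dotC _ e); case: (dot x f) (dot x e) => [b c] [b' c'] /=.
  by ring.
by ring.
Qed.

Lemma bounded_dualop a c : bounded_op (dualop dot e f a c : {linear H -> H}).
Proof.
exists (rnorm a + rnorm c) => x.
rewrite rmorphD /= -!norm_rnorm mulrDl /dualop.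
apply: le_trans (ler_normD _ _) _; rewrite !normrZ lerD2l.
rewrite ler_wpM2l//.
have ne : `|e| = 1.
  by apply/eqP; rewrite -(@pexpr_eq1 _ _ 2)// hdot ee.
rewrite ne mulr1 -ler_sqr ?nnegrE// -add_Re2_Im2 norm_rnorm -rmorphXn lecR.
apply: le_trans (bessel_ef x); rewrite lerDr.
by rewrite addr_ge0 ?sqr_ge0.
Qed.

End DualOperators.

(** * The contraction semigroup generated by -1 + 2 N *)

Lemma expR_ge_quadratic (R : realType) (t : R) : 0 <= t -> 1 + t + t ^+ 2 / 2 <= expR t.
Proof.
move=> t0; apply: (@le_trans _ _ (series (exp_coeff t) 3%N)).
  rewrite /series /= !big_nat_recr//= big_geq// add0r /exp_coeff /=.
  by rewrite expr0 expr1 !divr1.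
apply: nondecreasing_cvgn_le; last exact: is_cvg_series_exp_coeff.
by apply: nondecreasing_series => n _ _; exact: exp_coeff_ge0.
Qed.

Section ShearSemigroup.
Context {R : realType} {H : normedModType R[i]} (dot : {dot H for conjC}).
Hypothesis hdot : hilbert_norm dot.
Variables e f : H.
Hypothesis ee : dot e e = 1.
Hypothesis ff : dot f f = 1.
Hypothesis ef : dot e f = 0.

(** The exponential of [t (-1 + 2 N)]; the series stops at the linear term in
    [N]. *)
Definition shear_semigroup (t : R) : {linear H -> H} :=
  dualop dot e f (expR (- t))%:C (2 * t * expR (- t))%:C.

Lemma shear_semigroup0 x : shear_semigroup 0 x = x.
Proof.
by rewrite /shear_semigroup /= /dualop oppr0 expR0 mulr0 mul0r scale0r addr0 scale1r.
Qed.

Lemma shear_semigroupD s t x :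
  shear_semigroup (s + t) x = shear_semigroup s (shear_semigroup t x).
Proof.
rewrite /shear_semigroup /= dualopM// -!rmorphM -rmorphD /=.
by rewrite opprD expRD; congr (dualop _ _ _ _ _%:C _); ring.
Qed.

(** In the coordinates [a = <x, e>], [b = <x, f>] the claim reads
    [|x|^2 + 4 t Re (a conj(b)) + 4 t^2 |b|^2 <= exp (2 t) |x|^2]. The coefficient
    [2] of [N] is the largest for which this holds to first order, so the
    bound on [exp] has to be sharp up to the quadratic term. *)
Lemma shear_semigroup_contractive t x : 0 <= t ->
  rnorm (shear_semigroup t x) <= rnorm x.
Proof.
move=> t0; rewrite -ler_sqr ?nnegrE ?rnorm_ge0// (rnorm_dualop hdot)//.
have := bessel_ef hdot ee ff ef x; have := expR_ge_quadratic t0; have := expRxMexpNx_1 t.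
have := expR_gt0 (- t).
move: (expR (- t)) (expR t) (rnorm x ^+ 2) => s E X.
case: (dot x e) (dot x f) => [a1 a2] [b1 b2] /= s0 Es hE hX.
(* The difference of the two sides is [t (P a^2 - 4 a b + Q b^2)] where
   [P = 2 + 2 t + t^2] and [Q = 2 - 2 t + t^2]; since [P Q = 4 + t^4],
   multiplying by [P] completes the square. *)
have key (a b : R) : 4 * t * a * b + 4 * t ^+ 2 * b ^+ 2 <=
    t * (2 + 2 * t + t ^+ 2) * (a ^+ 2 + b ^+ 2).
  set P := 2 + 2 * t + t ^+ 2.
  have P0 : 0 < P by rewrite /P; nra.
  rewrite -(ler_pM2l P0) -subr_ge0.
  suff -> : P * (t * P * (a ^+ 2 + b ^+ 2)) - P * (4 * t * a * b + 4 * t ^+ 2 * b ^+ 2)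
    = t * ((P * a - 2 * b) ^+ 2 + t ^+ 4 * b ^+ 2).
    by rewrite mulr_ge0// addr_ge0 ?sqr_ge0// mulr_ge0 ?sqr_ge0// exprn_ge0.
  by rewrite /P; ring.
(* [(1 + t + t^2 / 2)^2 = 1 + t (2 + 2 t + t^2) + t^4 / 4]. *)
have hE2 : 1 + t * (2 + 2 * t + t ^+ 2) <= E ^+ 2.
  apply: (@le_trans _ _ ((1 + t + t ^+ 2 / 2) ^+ 2)).
    rewrite -subr_ge0 (_ : _ - _ = t ^+ 4 / 4); last by field.
    by rewrite divr_ge0// exprn_ge0.
  by rewrite lerXn2r// nnegrE; nra.
have X0 : 0 <= X by nra.
have hg : X + 4 * t * (a1 * b1 + a2 * b2) + 4 * t ^+ 2 * (b1 ^+ 2 + b2 ^+ 2) <=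
    E ^+ 2 * X.
  have := key a1 b1; have := key a2 b2.
  set k := t * _ in hE2 *; have k0 : 0 <= k by rewrite /k; nra.
  have : 0 <= (E ^+ 2 - 1 - k) * X by rewrite mulr_ge0//; lra.
  have : 0 <= k * (X - (a1 ^+ 2 + a2 ^+ 2 + (b1 ^+ 2 + b2 ^+ 2))).
    by rewrite mulr_ge0//; lra.
  by move=> *; lra.
have sEX : s ^+ 2 * (E ^+ 2 * X) = X.
  by rewrite mulrA -exprMn [s * E]mulrC Es expr1n mul1r.
rewrite -[leRHS]sEX; apply: le_trans (ler_wpM2l (sqr_ge0 s) hg).
by rewrite le_eqVlt; apply/orP; left; apply/eqP; ring.
Qed.

End ShearSemigroup.

Section Generator.
Context {R : realType} {H : normedModType R[i]} (dot : {dot H for conjC}).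
Hypothesis hdot : hilbert_norm dot.
Variables e f : H.
Hypothesis ee : dot e e = 1.
Hypothesis ff : dot f f = 1.
Hypothesis ef : dot e f = 0.

Lemma cvg_real_scale {T : Type} (F : set_system T) {FF : Filter F}
    (u : T -> R) (l : R) (v : H) :
  (u x @[x --> F] --> l)%classic ->
  ((u x)%:C *: v @[x --> F] --> l%:C *: v)%classic.
Proof.
move=> ul; apply: (@cvgZr_tmp R[i]).
apply/cvgrPdist_lt => eps eps0.
have epsE : eps = (complex.Re eps)%:C by rewrite RRe_real// gtr0_real.
have {}eps0 : 0 < complex.Re eps by rewrite -ltcR -epsE.
move/cvgrPdist_lt : ul => /(_ _ eps0); apply: filterS => x.
rewrite -rmorphB /= epsE normc_def /= expr0n addr0 sqrtr_sqr.
by rewrite ltcR.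
Qed.

Lemma continuous_shear_semigroup x :
  continuous (fun t : R => shear_semigroup dot e f t x).
Proof.
move=> t; have cE : {for t, continuous (fun r : R => expR (- r))}.
  by apply: continuous_comp; [exact: continuousN|exact: continuous_expR].
apply: cvgD; apply: cvg_real_scale; first exact: cE.
apply: cvgM => //; apply: cvgM; [exact: cvg_cst|exact: cvg_id].
Qed.

(** The difference quotient is
    [((exp (- t) - 1) / t) x + 2 exp (- t) N x], a combination of two fixed vectors
    with real coefficients. *)
Lemma shear_semigroup_generator :
  has_bounded_generator (shear_semigroup dot e f)
    (dualop dot e f (- 1%:C) 2%:C : {linear H -> H}).
Proof.
split; first exact: bounded_dualop.
move=> x; pose v := dot x f *: e.
pose u1 (t : R) := t^-1 * (expR (- t) - 1); pose u2 (t : R) := 2 * expR (- t).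
have u1l : (u1 t @[t --> 0^'+] --> (-1 : R))%classic.
  apply: cvg_dnbhs_at_right.
  have d : is_derive (0 : R) (1 : R) (expR \o -%R) (-1).
    by apply: is_derive_eq; rewrite oppr0 expR0 mul1r.
  have := ex_derive (is_derive := d); rewrite /derivable.
  have := derive_val (is_derive := d); rewrite /derive => -> .
  apply: cvg_trans; apply: near_eq_cvg.
  by near=> h; rewrite /u1 /= addr0 oppr0 expR0 [h *: 1]mulr1.
have u2l : (u2 t @[t --> 0^'+] --> (2 : R))%classic.
  have <- : u2 0 = 2 by rewrite /u2 oppr0 expR0 mulr1.
  apply: cvg_at_right_filter; apply: cvgM; first exact: cvg_cst.
  by apply: continuous_comp; [exact: continuousN|exact: continuous_expR].
have : ((u1 t)%:C *: x + (u2 t)%:C *: v @[t --> 0^'+] -->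
    (-1)%:C *: x + 2%:C *: v)%classic.
  by apply: cvgD; exact: cvg_real_scale.
rewrite rmorphN1; apply: cvg_trans; apply: near_eq_cvg; near=> t.
have t0 : t != 0 by rewrite gt_eqF//; near: t; exact: nbhs_right_gt.
rewrite /= /dualop -/v addrAC -{3}[x]scale1r -scalerBl scalerDr !scalerA.
rewrite -rmorphB -!rmorphM /=; rewrite [t^-1 * (2 * _ * _)](_ : _ = u2 t)//.
by rewrite /u2 -mulrA mulrCA mulKf.
Unshelve. all: by end_near.
Qed.

(** Off [z = a] the resolvent is again a dual number,
    [(z - a - c N)^-1 = (z - a)^-1 + c (z - a)^-2 N], so the spectrum is contained
    in [{a}]. *)
Lemma spectral_bound_dualop a c :
  (spectral_bound (dualop dot e f a c : {linear H -> H}) <= (complex.Re a)%:E)%E.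
Proof.
apply: ge_ereal_sup => _ [z hz <-]; rewrite lee_fin.
have [-> //|za] := eqVneq z a; exfalso; apply: hz.
have za0 : z - a != 0 by rewrite subr_eq0.
pose B : {linear H -> H} := dualop dot e f (z - a)^-1 (c * (z - a)^- 2).
exists B; first exact: bounded_dualop.
have resE x : z *: x - dualop dot e f a c x = dualop dot e f (z - a) (- c) x.
  by rewrite /dualop opprD addrA -scalerBl scaleNr.
move=> x; rewrite !resE /B /= !dualopM//.
rewrite mulVf// mulfV// (_ : _ * _ + _ = 0 :> R[i]); last by field.
by rewrite (_ : _ * _ + _ = 0 :> R[i]) ?/dualop ?scale0r ?addr0 ?scale1r//; field.
Qed.

(** * The d-parameter semigroup *)

Context {d : nat}.

Definition diagonal_family (t : 'rV[R]_d) : {linear H -> H} :=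
  shear_semigroup dot e f (\sum_i t 0 i).

Lemma marginal_diagonal_family i : marginal diagonal_family i = shear_semigroup dot e f.
Proof.
apply/funext => t; congr shear_semigroup.
rewrite (bigD1 i)//= big1 => [|j ji]; rewrite !mxE eqxx /= ?eqxx ?mulr1 ?addr0//.
by rewrite (negbTE ji) mulr0.
Qed.

Lemma orthant_sum_ge0 (t : 'rV[R]_d) : orthant t -> 0 <= \sum_i t 0 i.
Proof. by move=> t0; apply: sumr_ge0 => i _; exact: t0. Qed.

Lemma C0_diagonal_family : C0_semigroup diagonal_family.
Proof.
split=> [t _|x|s t _ _ x|x].
- exact: bounded_dualop.
- rewrite /diagonal_family big1 => [|i _]; first exact: shear_semigroup0.
  by rewrite mxE.
- rewrite /diagonal_family -shear_semigroupD//; congr (shear_semigroup _ _ _ _ x).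
  by rewrite -big_split; apply: eq_bigr => i _; rewrite mxE.
- apply: continuous_subspaceT => t.
  apply: (@continuous_comp _ _ _ (fun t : 'rV[R]_d => \sum_i t 0 i)
    (fun r => shear_semigroup dot e f r x)); last exact: continuous_shear_semigroup.
  apply: (@cvg_big R _ +%R 0 xpredT _ _ (nbhs t) _ (fun i (t : 'rV[R]_d) => t 0 i)).
    exact: add_continuous.
  by move=> i _; exact: coord_continuous.
Qed.

Lemma contractive_diagonal_family : contractive diagonal_family.
Proof.
move=> t /orthant_sum_ge0 t0; apply: ge_sup.
  by exists (rnorm (diagonal_family t 0)), 0 => //=; rewrite normr0.
move=> _ [x /= x1 <-]; apply: le_trans (shear_semigroup_contractive _ _ _ _ _ _) _ => //.
by rewrite -lecR -norm_rnorm.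
Qed.

End Generator.

(** * The test polynomial *)

Section LaurentPolynomials.
Context {R : realType} {d : nat}.
Implicit Type s : seq (R[i] * {ffun 'I_d -> int}).

Definition laurent_of_terms s : laurent R d :=
  [fsfun n in [fset c.2 | c in s]%fset => \sum_(c <- s | c.2 == n) c.1 | 0].

(** Serves both evaluations: [F n] is a product of powers of scalars in one and
    a regular monomial in the other. *)
Lemma sum_laurent_of_terms s (V : lmodType R[i]) (F : {ffun 'I_d -> int} -> V) :
  \sum_(n <- finsupp (laurent_of_terms s)) laurent_of_terms s n *: F n =
  \sum_(c <- s) c.1 *: F c.2.
Proof.
set S := [fset c.2 | c in s]%fset.
have sS : (finsupp (laurent_of_terms s) `<=` S)%fset by exact: finsupp_sub.
rewrite (big_fset_incl _ sS) /= => [|n nS nn]; last first.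
  by rewrite (fsfun_dflt nn) scale0r.
transitivity (\sum_(n <- S) \sum_(c <- s | c.2 == n) c.1 *: F c.2).
  apply: eq_big_seq => n nS; rewrite fsfunE nS scaler_suml.
  by apply: eq_bigr => c /eqP ->.
rewrite (exchange_big_dep xpredT)//= big_seq [RHS]big_seq; apply: eq_bigr => c cs.
under eq_bigl do rewrite eq_sym.
rewrite (@fbig_pred1_inj _ _ _ _ _ _ id)//.
by apply/imfsetP; exists c.
Qed.

(** The exponent of [X_i0 ^ j X_i1 ^ k]. *)
Definition expo2 (i0 i1 : 'I_d) (j k : int) : {ffun 'I_d -> int} :=
  [ffun i => if i == i0 then j else if i == i1 then k else 0].

Lemma big_expo2 (T : Type) (idx : T) (op : Monoid.com_law idx)
    (g : 'I_d -> int -> T) (i0 i1 : 'I_d) (j k : int) :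
  i1 != i0 -> (forall i, g i 0 = idx) ->
  \big[op/idx]_i g i (expo2 i0 i1 j k i) = op (g i0 j) (g i1 k).
Proof.
move=> i10 g0; rewrite (bigD1 i0)//= (bigD1 i1)//= big1 ?Monoid.mulm1.
  by rewrite !ffunE !eqxx (negbTE i10).
by move=> i /andP[ii0 ii1]; rewrite ffunE (negbTE ii0) (negbTE ii1) g0.
Qed.

(** The expansion of [16 - (2 - X - X^-1) (2 - Y - Y^-1)] for [X = X_i0] and
    [Y = X_i1]. *)
Definition test_laurent (i0 i1 : 'I_d) : laurent R d := laurent_of_terms
  [:: (12, expo2 i0 i1 0 0);
      (2, expo2 i0 i1 1 0); (2, expo2 i0 i1 (-1) 0);
      (2, expo2 i0 i1 0 1); (2, expo2 i0 i1 0 (-1));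
      (-1, expo2 i0 i1 1 1); (-1, expo2 i0 i1 1 (-1));
      (-1, expo2 i0 i1 (-1) 1); (-1, expo2 i0 i1 (-1) (-1))].

Lemma test_laurent_eval i0 i1 z : i1 != i0 ->
  laurent_eval (test_laurent i0 i1) z =
  16 - (2 - z i0 - (z i0)^-1) * (2 - z i1 - (z i1)^-1).
Proof.
move=> i10.
transitivity (\sum_(n <- finsupp (test_laurent i0 i1)) test_laurent i0 i1 n *:
  (\prod_(i < d) z i ^ n i : R[i]^o)) => //.
rewrite sum_laurent_of_terms.
rewrite !big_cons big_nil /=.
rewrite !(big_expo2 *%R (g := fun i n => z i ^ n))//.
by rewrite !expr0z !expr1z !exprN1 /GRing.scale /=; ring.
Qed.

(** On the unit circle [2 - z - z^-1 = |1 - z|^2]. *)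
Lemma unit_circle_factor (z : R[i]) : `|z| = 1 -> 0 <= 2 - z - z^-1 <= 4.
Proof.
move=> z1; have z0 : z != 0 by rewrite -normr_gt0 z1.
have -> : 2 - z - z^-1 = `|1 - z| ^+ 2.
  have zc : z^-1 = z^* by rewrite invC_norm z1 expr1n invr1 mul1r.
  rewrite normCK (_ : (1 - z)^* = 1 - z^-1); first by field.
  by rewrite zc rmorphB rmorph1.
rewrite exprn_ge0//= (_ : 4 = 2 ^+ 2); last by rewrite -natrX.
rewrite lerXn2r ?nnegrE// (le_trans (ler_normB _ _))// z1 normr1.
by rewrite -(natrD _ 1 1).
Qed.

Lemma test_laurent_sup i0 i1 : i1 != i0 -> laurent_sup (test_laurent i0 i1) <= 16.
Proof.
move=> i10; apply: ge_sup.
  exists (rnorm (laurent_eval (test_laurent i0 i1) (fun=> 1))).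
  by exists (fun=> 1) => // i; rewrite normr1.
move=> _ [z /= hz <-]; rewrite test_laurent_eval//.
have /andP[] := unit_circle_factor (hz i0); set P := 2 - _ - _ => P0 P4.
have /andP[] := unit_circle_factor (hz i1); set Q := 2 - _ - _ => Q0 Q4.
have PQ : P * Q <= 16.
  by apply: le_trans (ler_pM P0 Q0 P4 Q4) _; rewrite -natrM.
rewrite -lecR -norm_rnorm /= ger0_norm ?subr_ge0//.
by rewrite (_ : 16%:C = 16) ?gerBl ?mulr_ge0// rmorph_nat.
Qed.

End LaurentPolynomials.

(** * Failure of the regular polynomial bounds *)

Section RegularBounds.
Context {R : realType} {H : normedModType R[i]} (dot : {dot H for conjC}).
Hypothesis hdot : hilbert_norm dot.
Variables e f : H.
Hypothesis ee : dot e e = 1.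
Hypothesis ff : dot f f = 1.
Hypothesis ef : dot e f = 0.
Context {d : nat}.
Implicit Type n : {ffun 'I_d -> int}.

Let S := shear_semigroup dot e f.

Definition pos_degree n : nat := (\sum_(i < d | (0 < n i)%R) `|n i|)%N.
Definition neg_degree n : nat := (\sum_(i < d | (n i < 0)%R) `|n i|)%N.

Lemma comp_iter_shear (P : pred 'I_d) (m : 'I_d -> nat) (r : R) :
  \big[(fun g h => g \o h)/id]_(i < d | P i) iter (m i) (S r) =
  S (r *+ (\sum_(i < d | P i) m i)%N) :> (H -> H).
Proof.
have iterS k x : iter k (S r) x = S (r *+ k) x.
  elim: k => [|k IH]; first by rewrite mulr0n [RHS]shear_semigroup0.
  by rewrite iterS IH mulrS [RHS]shear_semigroupD.
elim/big_rec2: _ => [|i k g _ ->]; apply/funext => x.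
  by rewrite mulr0n [RHS]shear_semigroup0.
by rewrite /= iterS mulrnDr [RHS]shear_semigroupD.
Qed.

Lemma regular_monomial_shear n (r : R) x :
  regular_monomial dot n (fun=> S r) x =
  adjoint dot (S (r *+ neg_degree n)) (S (r *+ pos_degree n) x).
Proof. by rewrite /regular_monomial !comp_iter_shear. Qed.

Lemma shear_adjoint r : exists g, forall u v, dot (S r u) v = dot u (g v).
Proof. by eexists=> u v; exact: dualop_adjoint. Qed.

(** The adjoint of the negative part moves to the other side of the inner
    product; only the two total degrees matter because all the operators are
    equal to the same member of the semigroup. *)
Lemma dot_regular_monomial n (r : R) x :
  dot (regular_monomial dot n (fun=> S r) x) x =
  dot (S (r *+ pos_degree n) x) (S (r *+ neg_degree n) x).
Proof.
have [g hg] := shear_adjoint (r *+ neg_degree n).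
by rewrite regular_monomial_shear dotC -(dot_adjoint _ _ hg) -dotC.
Qed.

Lemma norm_regular_monomial n (r : R) x : 0 <= r ->
  `|regular_monomial dot n (fun=> S r) x| <= `|x|.
Proof.
move=> r0; have [g hg] := shear_adjoint (r *+ neg_degree n).
have ctr k u : rnorm (S (r *+ k) u) <= rnorm u.
  by apply: shear_semigroup_contractive => //; rewrite mulrn_wge0.
rewrite regular_monomial_shear !norm_rnorm lecR.
by apply: le_trans (ctr (pos_degree n) x); apply: rnorm_adjoint hg _.
Qed.

(** Since [opnorm] is a supremum, the point is that the operator is bounded:
    regular monomials in contractions are contractions, so the sum of the
    absolute values of the coefficients is a bound. *)
Lemma regular_eval_le_opnorm (p : laurent R d) (r : R) x : 0 <= r -> `|x| <= 1 ->
  rnorm (regular_eval dot p (fun=> S r) x) <= opnorm (regular_eval dot p (fun=> S r)).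
Proof.
move=> r0 x1; apply: ub_le_sup; last by exists x.
exists (complex.Re (\sum_(n <- finsupp p) `|p n|)) => _ [y /= y1 <-].
suff : `|regular_eval dot p (fun=> S r) y| <= \sum_(n <- finsupp p) `|p n|.
  by rewrite lecE => /andP[].
apply: le_trans (ler_norm_sum _ _ _) _; apply: ler_sum => n _.
rewrite normrZ -[leRHS]mulr1 ler_wpM2l//.
exact: le_trans (norm_regular_monomial _ _ r0) y1.
Qed.

(** A unit vector with rational coordinates at which
    [|A x|^2 + Re <A^2 x, x>] is negative for [A = -1 + 2 N]. *)
Definition test_vector : H := (4 / 5)%:C *: e + (3 / 5)%:C *: f.

Lemma dot_ef_real (a b a' b' : R) :
  dot (a%:C *: e + b%:C *: f) (a'%:C *: e + b'%:C *: f) = (a * a' + b * b')%:C.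
Proof.
have fe : dot f e = 0 by rewrite dotC ef rmorph0.
rewrite !dotDl !dotDr !dotZl !dotZr ee ff ef fe !mulr0 !mulr1 addr0 add0r.
by rewrite rmorphD !rmorphM /= ![_^*]conjc_real.
Qed.

Lemma shear_test_vector r : S r test_vector =
  (expR (- r) * (4 / 5 + 2 * r * (3 / 5)))%:C *: e + (expR (- r) * (3 / 5))%:C *: f.
Proof.
rewrite /S /shear_semigroup /= /dualop /test_vector dotDl !dotZl ef ff mulr0 add0r mulr1.
rewrite scalerDr !scalerA -!rmorphM /= addrAC -scalerDl -rmorphD /=.
by congr (_%:C *: _ + _); ring.
Qed.

(** The value of [<S (j r) x, S (k r) x>] at the test vector [x]. *)
Definition test_moment (r : R) (j k : nat) : R :=
  (expR (- (r *+ j)) * (4 / 5 + 2 * (r *+ j) * (3 / 5))) *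
  (expR (- (r *+ k)) * (4 / 5 + 2 * (r *+ k) * (3 / 5))) +
  (expR (- (r *+ j)) * (3 / 5)) * (expR (- (r *+ k)) * (3 / 5)).

Lemma rdot_test_laurent (i0 i1 : 'I_d) (r : R) : i1 != i0 ->
  rdot dot (regular_eval dot (test_laurent i0 i1) (fun=> S r) test_vector) test_vector =
  12 + 4 * (test_moment r 1 0 + test_moment r 0 1) -
  (test_moment r 2 0 + test_moment r 0 2 + 2 * test_moment r 1 1).
Proof.
move=> i10.
have moment n : dot (regular_monomial dot n (fun=> S r) test_vector) test_vector =
    (test_moment r (pos_degree n) (neg_degree n))%:C.
  by rewrite dot_regular_monomial !shear_test_vector dot_ef_real.
have pos j k : pos_degree (expo2 i0 i1 j k) =
    ((if (0 < j)%R then `|j| else 0) + (if (0 < k)%R then `|k| else 0))%N.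
  by rewrite /pos_degree big_mkcond
    (big_expo2 addn (g := fun _ (m : int) => if (0 < m)%R then `|m| else 0)%N).
have neg j k : neg_degree (expo2 i0 i1 j k) =
    ((if (j < 0)%R then `|j| else 0) + (if (k < 0)%R then `|k| else 0))%N.
  by rewrite /neg_degree big_mkcond
    (big_expo2 addn (g := fun _ (m : int) => if (m < 0)%R then `|m| else 0)%N).
rewrite /regular_eval sum_laurent_of_terms /rdot.
rewrite !big_cons big_nil /= !dotDl !dotZl !moment !pos !neg /=.
have -> : dot 0 test_vector = 0 by exact: linear0l.
have natC k : k%:R = (k%:R : R)%:C by rewrite rmorph_nat.
have m00 : test_moment r 0 0 = 1.
  by rewrite /test_moment mulr0n oppr0 expR0; field.
rewrite addr0 -[-1](rmorphN1 (real_complex R)) (natC 12) (natC 2).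
rewrite -!rmorphM -!rmorphD /= !addn0 !add0n m00.
by ring.
Qed.

(** With [s = exp (- r)] the right-hand side is a concave quadratic polynomial
    in [s] which exceeds [16] for [s] in an interval containing [[3/4, 4/5]]. *)
Lemma test_moments_large (r : R) : r = 1 / 4 ->
  16 < 12 + 4 * (test_moment r 1 0 + test_moment r 0 1) -
    (test_moment r 2 0 + test_moment r 0 2 + 2 * test_moment r 1 1).
Proof.
move=> rE; rewrite /test_moment !mulr0n !mulr1n oppr0 expR0 mulr2n (opprD r r) expRD.
have s_ge : 3 / 4 <= expR (- r).
  by apply: le_trans (expR_ge1Dx _); rewrite rE; lra.
(* From [exp (- r) exp r = 1] and [exp r >= 1 + r = 5/4]. *)
have s_le : expR (- r) <= 4 / 5.
  have := expRxMexpNx_1 r; have := expR_ge1Dx r; have := expR_gt0 (- r).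
  by move: (expR (- r)) (expR r) => s E; rewrite rE; nra.
move: (expR (- r)) s_ge s_le => s; rewrite rE; nra.
Qed.

Lemma norm_test_vector : `|test_vector| = 1.
Proof.
apply/eqP; rewrite -(@pexpr_eq1 _ _ 2)// hdot dot_ef_real.
by rewrite (_ : _ + _ = 1)//; field.
Qed.

Lemma diagonal_family_not_regular : (2 <= d)%N ->
  ~ regular_polynomial_bounds dot (diagonal_family dot e f : 'rV[R]_d -> _).
Proof.
move=> hd; set i0 := Ordinal (ltnW hd); set i1 := Ordinal hd.
have i10 : i1 != i0 by [].
have [r rE] : exists r : R, r = 1 / 4 by exists (1 / 4).
have r0 : 0 <= r by rewrite rE divr_ge0.
pose p : laurent R d := test_laurent i0 i1.
pose t : 'rV[R]_d := const_mx r.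
move=> /(_ p t) rpb.
have {}rpb : opnorm (regular_eval dot p (fun=> S r)) <= laurent_sup p.
  have -> : (fun=> S r : H -> H) = (fun i : 'I_d =>
      marginal (diagonal_family dot e f) i (t 0 i) : H -> H).
    by apply/funext => i; rewrite marginal_diagonal_family mxE.
  by apply: rpb => i; rewrite mxE.
set v := regular_eval dot p (fun=> S r) test_vector.
have v16 : rnorm v <= 16.
  apply: le_trans (test_laurent_sup i10); apply: le_trans rpb.
  by apply: regular_eval_le_opnorm => //; rewrite norm_test_vector.
have vx16 : 16 < rdot dot v test_vector.
  by rewrite rdot_test_laurent//; exact: test_moments_large.
have xx : rdot dot test_vector test_vector = 1.
  by rewrite (rdotxx hdot) /rnorm norm_test_vector expr1n.
(* [|v| <= 16] and [Re <v, x> > 16] contradict [|v - 16 x|^2 >= 0]. *)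
have := sqr_ge0 (rnorm (v - 16%:C *: test_vector)).
rewrite -(rdotxx hdot) rdotBl !rdotBr !rdotZl !rdotZr xx (rdotC _ _ v) (rdotxx hdot).
have := rnorm_ge0 v; nra.
Qed.

End RegularBounds.

Theorem corollary1p5 (R : realType) (H : completeNormedModType R[i])
  (dot : {dot H for conjC}) (hdot : hilbert_norm dot) (hdim : dim_ge H 2)
  (d : nat) (hd : (2 <= d)%N) :
  exists T : 'rV[R]_d -> {linear H -> H},
    [/\ C0_semigroup T,
        contractive T,
        (exists A : 'I_d -> {linear H -> H}, forall i : 'I_d,
           has_bounded_generator (marginal T i) (A i) /\
           (spectral_bound (A i) < 0)%E)
      & ~ regular_polynomial_bounds dot T].
Proof.
have [e [f [ee ff ef]]] := orthonormal_pair hdot hdim.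
exists (diagonal_family dot e f); split.
- exact: C0_diagonal_family.
- exact: contractive_diagonal_family.
- exists (fun=> dualop dot e f (- 1%:C) 2%:C) => i; split.
    by rewrite marginal_diagonal_family; exact: shear_semigroup_generator.
  apply: le_lt_trans (spectral_bound_dualop hdot ee ff ef _ _) _.
  by rewrite lte_fin /= oppr_lt0.
- exact: diagonal_family_not_regular.
Qed.
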